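(* The following isomorphisms of $\mathcal{A}_1$-modules hold: (1) $S_\epsilon\otimes S\cong S\cong S\otimes S_\epsilon$ for every simple $\mathcal{A}_1$-module $S$. (2) $S_{\operatorname{sgn}}\otimes S_{\operatorname{st}}(\theta)\cong S_{\operatorname{st}}(\vartheta)$, for $\theta,\vartheta\in\{\pm\mathrm{i},\pm\frac{\mathrm{i}}{3}\}$ with $\operatorname{sg}(\theta)=\operatorname{sg}(\vartheta)$, $|\theta|\neq|\vartheta|$. (3) $S_{\operatorname{st}}(\theta)\otimes S_{\operatorname{sgn}}\cong S_{\operatorname{st}}(\vartheta)$, for $\theta,\vartheta\in\{\pm\mathrm{i},\pm\frac{\mathrm{i}}{3}\}$ with $\operatorname{sg}(\theta)=-\operatorname{sg}(\vartheta)$, $|\theta|\neq|\vartheta|$. (4) - $S_{\operatorname{st}}(\mathrm{i})\otimes S_{\operatorname{st}}(\mathrm{i})\cong S_{\operatorname{st}}(-\frac{\mathrm{i}}3)\otimes S_{\operatorname{st}}(\frac{\mathrm{i}}3)\cong M(0,2\mathrm{i},1,1,0,0)[-\mathrm{i}]$; - $S_{\operatorname{st}}(\mathrm{i})\otimes S_{\operatorname{st}}(-\mathrm{i})\cong S_{\operatorname{st}}(-\frac{\mathrm{i}}3)\otimes S_{\operatorname{st}}(-\frac{\mathrm{i}}3)\cong M(1,0,0,0,-\frac{2\mathrm{i}}3,1)[\frac{\mathrm{i}}3]$; - $S_{\operatorname{st}}(\mathrm{i})\otimes S_{\operatorname{st}}(\frac{\mathrm{i}}3)\cong S_{\operatorname{st}}(-\frac{\mathrm{i}}3)\otimes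 S_{\operatorname{st}}(\mathrm{i})\cong M(0,0,1,0,1,2\mathrm{i})[-\mathrm{i}]$; - $S_{\operatorname{st}}(\mathrm{i})\otimes S_{\operatorname{st}}(-\frac{\mathrm{i}}3)\cong S_{\operatorname{st}}(-\frac{\mathrm{i}}3)\otimes S_{\operatorname{st}}(-\mathrm{i})\cong M(1,1,0,-\frac{2\mathrm{i}}3,0,0)[\frac{\mathrm{i}}3]$; - $S_{\operatorname{st}}(-\mathrm{i})\otimes S_{\operatorname{st}}(\mathrm{i})\cong S_{\operatorname{st}}(\frac{\mathrm{i}}3)\otimes S_{\operatorname{st}}(\frac{\mathrm{i}}3)\cong M(1,0,0,0,\frac{2\mathrm{i}}3,1)[-\frac{\mathrm{i}}3]$; - $S_{\operatorname{st}}(-\mathrm{i})\otimes S_{\operatorname{st}}(-\mathrm{i})\cong S_{\operatorname{st}}(\frac{\mathrm{i}}3)\otimes S_{\operatorname{st}}(-\frac{\mathrm{i}}3)\cong M(0,-2\mathrm{i},1,1,0,0)[\mathrm{i}]$; - $S_{\operatorname{st}}(-\mathrm{i})\otimes S_{\operatorname{st}}(\frac{\mathrm{i}}3)\cong S_{\operatorname{st}}(\frac{\mathrm{i}}3)\otimes S_{\operatorname{st}}(\mathrm{i})\cong M(1,1,0,\frac{2\mathrm{i}}3,0,0)[-\frac{\mathrm{i}}3]$; - $S_{\operatorname{st}}(-\mathrm{i})\otimes S_{\operatorname{st}}(-\frac{\mathrm{i}}3)\cong S_{\operatorname{st}}(\frac{\mathrm{i}}3)\otimes S_{\operatorname{st}}(-\mathrm{i})\cong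 M(0,0,1,0,1,-2\mathrm{i})[\mathrm{i}]$.
   Context: $\Bbbk$ is an algebraically closed field of characteristic zero, $\mathrm{i}=\sqrt{-1}\in\Bbbk$. $\mathcal{A}_1$ is the 72-dimensional Hopf algebra generated as an algebra by $H_t$ ($t\in\mathbb{S}_3$) and $a_{12},a_{13},a_{23}$ (indexed by the transpositions of $\mathbb{S}_3$; $H_{12}=H_{(12)}$, etc.), with relations $H_e=1$, $H_tH_s=H_{ts}$; $H_ta_i=\operatorname{sgn}(t)a_{tit^{-1}}H_t$; $a_{12}^2=0$; $a_{12}a_{23}+a_{23}a_{13}+a_{13}a_{12}=1-H_{12}H_{23}$; comultiplication $\Delta(H_t)=H_t\otimes H_t$, $\Delta(a_i)=H_i\otimes a_i+a_i\otimes1$. Tensor products of modules are taken via $\Delta$. Since $a_{13}=-H_{23}a_{12}H_{23}$ and $a_{23}=-H_{13}a_{12}H_{13}$, a module is determined by the $\mathbb{S}_3$-action (via $t\mapsto H_t$) and the action of $a_{12}$. $S_\epsilon$, $S_{\operatorname{sgn}}$ are the one-dimensional modules where $H_t$ acts by the trivial, resp. sign, character and all $a_i$ act by $0$. The standard representation $W_{\operatorname{st}}$ of $\mathbb{S}_3$ has canonical basis $\{v,w\}$ with $H_{12}v=w$, $H_{12}w=v$; $H_{23}v=v-w$, $H_{23}w=-w$; $H_{13}v=-v$, $H_{13}w=-v+w$. $S_{\operatorname{st}}(\theta)$ is $W_{\operatorname{st}}$ with $a_{12}v=a_{12}w=\theta(v-w)$ for $\theta=\pm\mathrm{i}$, and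 with $a_{12}v=\theta(v+w)$, $a_{12}w=-\theta(v+w)$ for $\theta=\pm\frac{\mathrm{i}}{3}$. The simple $\mathcal{A}_1$-modules are $S_\epsilon,S_{\operatorname{sgn}}$ and the four $S_{\operatorname{st}}(\theta)$. For scalars $\alpha,\beta,\gamma,\eta,a,b\in\Bbbk$ and $\theta\in\{\pm\mathrm{i},\pm\frac{\mathrm{i}}3\}$, $M(\alpha,\beta,\gamma,\eta,a,b)[\theta]$ denotes (when this defines a module) the $\mathcal{A}_1$-module with basis $x,y,v,w$, where $x$ spans the trivial, $y$ the sign, and $v,w$ (canonical basis) the standard representation of $\mathbb{S}_3$, and $a_{12}x=\alpha y+\beta(v-w)$, $a_{12}y=\gamma x+\eta(v+w)$, $a_{12}v=ax+by+cv+dw$, $a_{12}w=-ax+by-dv-cw$, with $c=\theta$, and $d=c$ if $\theta=\pm\frac{\mathrm{i}}3$, $d=-c$ if $\theta=\pm\mathrm{i}$. The sign function is $\operatorname{sg}(\mathrm{i}s)=1$ if $s>0$ and $-1$ if $s<0$, and $|\cdot|$ is the absolute value, so $|\pm\mathrm{i}|=1$, $|\pm\frac{\mathrm{i}}3|=\frac13$. *)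

(* Defs.v *)
From HB Require Import structures.
From mathcomp Require Import all_boot all_order all_algebra all_fingroup.
From mathcomp Require Import sesquilinear generic_quotient boolp.

Set Implicit Arguments.
Unset Strict Implicit.
Unset Printing Implicit Defensive.

Import GRing.Theory.
Local Open Scope ring_scope.
Local Open Scope quotient_scope.

(** [tensor V W] is the quotient of the formal finite sums of pairs [(v, w)]
    (lists, added by concatenation) in which two sums are identified when every
    bilinear map takes the same value on them.  The universal property is
    given by [tlift], [tlift_pure] and [tensor_ext]. *)

Section Tensor.
Variables (k : fieldType) (V W : lmodType k).

Definition bsum (U : lmodType k) (B : V -> W -> U) (s : seq (V * W)) : U :=
  \sum_(p <- s) B p.1 p.2.

Definition tensor_rel (s t : seq (V * W)) : bool :=
  `[< forall (U : lmodType k) (B : {bilinear V -> W -> U}),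
        bsum B s = bsum B t >].

Lemma tensor_relP s t :
  reflect (forall (U : lmodType k) (B : {bilinear V -> W -> U}),
             bsum B s = bsum B t) (tensor_rel s t).
Proof. exact: asboolP. Qed.

Lemma tensor_rel_equiv : equiv_class_of tensor_rel.
Proof.
split=> [s | s t | t s u].
- exact/tensor_relP.
- by apply/tensor_relP/tensor_relP => h U B; rewrite h.
- by move=> /tensor_relP h1 /tensor_relP h2; apply/tensor_relP=> U B; rewrite h1.
Qed.

Canonical tensor_equiv := EquivRelPack tensor_rel_equiv.
Definition tensor := {eq_quot tensor_equiv}.
HB.instance Definition _ := Choice.on tensor.
HB.instance Definition _ := EqQuotient.on tensor.

Lemma bsum_cat (U : lmodType k) (B : {bilinear V -> W -> U}) s t :
  bsum B (s ++ t) = bsum B s + bsum B t.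
Proof. by rewrite /bsum big_cat. Qed.

Definition scale_seq (c : k) (s : seq (V * W)) := [seq (c *: p.1, p.2) | p <- s].

Lemma bsum_scale (U : lmodType k) (B : {bilinear V -> W -> U}) c s :
  bsum B (scale_seq c s) = c *: bsum B s.
Proof.
by rewrite /bsum big_map scaler_sumr; apply: eq_bigr => p _; rewrite linearZl_LR.
Qed.

Definition tclass (s : seq (V * W)) : tensor := \pi_tensor s.

Lemma tclassP s t :
  (forall (U : lmodType k) (B : {bilinear V -> W -> U}), bsum B s = bsum B t) ->
  tclass s = tclass t.
Proof. by move=> h; apply/eqmodP/tensor_relP. Qed.

Lemma bsum_repr s (U : lmodType k) (B : {bilinear V -> W -> U}) :
  bsum B (repr (tclass s)) = bsum B s.
Proof.
have /eqmodP/tensor_relP : \pi_tensor (repr (tclass s)) = \pi_tensor s.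
  by rewrite reprK.
exact.
Qed.

Lemma tclass_repr (x : tensor) : tclass (repr x) = x.
Proof. exact: reprK. Qed.

Definition tadd (x y : tensor) : tensor := tclass (repr x ++ repr y).
Definition tscale (c : k) (x : tensor) : tensor := tclass (scale_seq c (repr x)).
Definition topp (x : tensor) : tensor := tscale (-1) x.
Definition tzero : tensor := tclass [::].

Let tE := (bsum_cat, bsum_scale, bsum_repr).

Lemma taddA : associative tadd.
Proof. by move=> x y z; apply: tclassP => U B; rewrite !tE addrA. Qed.
Lemma taddC : commutative tadd.
Proof. by move=> x y; apply: tclassP => U B; rewrite !tE addrC. Qed.
Lemma tadd0 : left_id tzero tadd.
Proof.
move=> x; rewrite -[RHS]tclass_repr; apply: tclassP => U B.
by rewrite !tE /bsum big_nil add0r.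
Qed.
Lemma taddN : left_inverse tzero topp tadd.
Proof.
move=> x; apply: tclassP => U B.
by rewrite !tE scaleN1r addNr /bsum big_nil.
Qed.

HB.instance Definition _ :=
  GRing.isZmodule.Build tensor taddA taddC tadd0 taddN.

Lemma tscaleA a b x : tscale a (tscale b x) = tscale (a * b) x.
Proof. by apply: tclassP => U B; rewrite !tE scalerA. Qed.
Lemma tscale1 : left_id 1 tscale.
Proof.
move=> x; rewrite -[RHS]tclass_repr; apply: tclassP => U B.
by rewrite !tE scale1r.
Qed.
Lemma tscaleDr : right_distributive tscale +%R.
Proof. by move=> a x y; apply: tclassP => U B; rewrite !tE scalerDr. Qed.
Lemma tscaleDl x : {morph tscale^~ x : a b / a + b}.
Proof. by move=> a b; apply: tclassP => U B; rewrite !tE scalerDl. Qed.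

HB.instance Definition _ :=
  GRing.Zmodule_isLmodule.Build k tensor tscaleA tscale1 tscaleDr tscaleDl.

Definition pure (v : V) (w : W) : tensor := tclass [:: (v, w)].

Lemma bsum1 (U : lmodType k) (B : V -> W -> U) v w : bsum B [:: (v, w)] = B v w.
Proof. by rewrite /bsum big_seq1. Qed.

Lemma pure_bilinear : bilinear_for *:%R *:%R pure.
Proof.
split=> [w | v] a x y; apply: tclassP => U B; rewrite !tE !bsum1.
  by rewrite linearPl.
by rewrite linearPr.
Qed.

HB.instance Definition _ :=
  bilinear_isBilinear.Build k V W tensor *:%R *:%R pure pure_bilinear.

Section Lift.
Variables (U : lmodType k) (B : {bilinear V -> W -> U}).

Definition tlift (x : tensor) : U := bsum B (repr x).

Lemma tlift_is_linear : linear tlift.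
Proof. by move=> a x y; rewrite /tlift !tE. Qed.

HB.instance Definition _ :=
  GRing.isLinear.Build k tensor U *:%R tlift tlift_is_linear.

Lemma tlift_pure v w : tlift (pure v w) = B v w.
Proof. by rewrite /tlift bsum_repr bsum1. Qed.

End Lift.

Lemma tensorE (x : tensor) : x = \sum_(p <- repr x) pure p.1 p.2.
Proof.
rewrite -[LHS]tclass_repr; elim: (repr x) => [|[v w] s IHs].
  by rewrite big_nil.
rewrite big_cons /= -IHs; apply: tclassP => U B.
by rewrite !tE bsum1 /bsum big_cons.
Qed.

Lemma tensor_ext (U : lmodType k) (f g : {linear tensor -> U}) :
  (forall v w, f (pure v w) = g (pure v w)) -> f =1 g.
Proof.
move=> fg x; rewrite (tensorE x) !linear_sum.
by apply: eq_bigr => p _; apply: fg.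
Qed.

End Tensor.

Section TensorMap.
Variables (k : fieldType) (V W V' W' : lmodType k).
Variables (f : {linear V -> V'}) (g : {linear W -> W'}).

Definition tmap_fun (v : V) (w : W) : tensor V' W' := pure (f v) (g w).

Lemma tmap_bilinear : bilinear_for *:%R *:%R tmap_fun.
Proof.
split=> [w | v] a x y; rewrite /tmap_fun linearP; first by rewrite linearPl.
by rewrite linearPr.
Qed.

HB.instance Definition _ :=
  bilinear_isBilinear.Build k V W (tensor V' W') *:%R *:%R tmap_fun tmap_bilinear.

Definition tmap : {linear tensor V W -> tensor V' W'} := tlift tmap_fun.

Lemma tmapE v w : tmap (pure v w) = pure (f v) (g w).
Proof. exact: tlift_pure. Qed.

End TensorMap.

(* The letters 1, 2, 3 permuted by S_3. *)
Definition l1 : 'I_3 := @Ordinal 3 0 isT.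
Definition l2 : 'I_3 := @Ordinal 3 1 isT.
Definition l3 : 'I_3 := @Ordinal 3 2 isT.

Definition is_transposition (s : 'S_3) : bool :=
  [exists i, exists j, (i != j) && (s == tperm i j)].

Definition transposition := {s : 'S_3 | is_transposition s}.

Lemma tperm_is_transposition (i j : 'I_3) :
  i != j -> is_transposition (tperm i j).
Proof. by move=> ij; apply/existsP; exists i; apply/existsP; exists j; rewrite ij /=. Qed.

Definition t12 : transposition :=
  exist _ (tperm l1 l2) (@tperm_is_transposition l1 l2 isT).
Definition t13 : transposition :=
  exist _ (tperm l1 l3) (@tperm_is_transposition l1 l3 isT).
Definition t23 : transposition :=
  exist _ (tperm l2 l3) (@tperm_is_transposition l2 l3 isT).

(* A_1 is given by generators and relations, so an A_1-module is a vector space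
   with operators for the generators ([A1data]) that satisfy the relations
   ([is_A1module]); [A1iso] and [A1simple] include the latter. *)
Record A1data (k : fieldType) := MkA1data {
  carrier :> lmodType k;
  Hact : 'S_3 -> {linear carrier -> carrier};
  aact : transposition -> {linear carrier -> carrier}
}.
Arguments Hact {k} _ _.
Arguments aact {k} _ _.

(* The defining relations of A_1.  Products of permutations are written there
   in functional order: the product [ts] (first s, then t) is [(s * t)%g], and
   [t i t^-1] is [(i ^ t)%g]. *)
Record is_A1module (k : fieldType) (V : A1data k) : Prop := {
  A1_H1 : forall v : V, Hact V 1%g v = v;
  A1_HM : forall (t s : 'S_3) (v : V),
    Hact V t (Hact V s v) = Hact V (s * t)%g v;
  A1_Ha : forall (t : 'S_3) (i j : transposition) (v : V),
    val j = (val i ^ t)%g ->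
    Hact V t (aact V i v) = (-1) ^+ odd_perm t *: aact V j (Hact V t v);
  A1_a12 : forall v : V, aact V t12 (aact V t12 v) = 0;
  A1_aa : forall v : V,
    aact V t12 (aact V t23 v) + aact V t23 (aact V t13 v)
      + aact V t13 (aact V t12 v)
    = v - Hact V (val t12) (Hact V (val t23) v)
}.

Definition A1iso (k : fieldType) (V W : A1data k) : Prop :=
  [/\ is_A1module V, is_A1module W &
      exists f : {linear V -> W},
        [/\ bijective f,
            forall t v, f (Hact V t v) = Hact W t (f v) &
            forall i v, f (aact V i v) = aact W i (f v)]].

Definition A1simple (k : fieldType) (V : A1data k) : Prop :=
  [/\ is_A1module V,
      exists v : V, v != 0 &
      forall P : {pred V},
        GRing.submod_closed P ->
        (forall t, {in P, forall v, Hact V t v \in P}) ->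
        (forall i, {in P, forall v, aact V i v \in P}) ->
        (forall v, v \in P -> v = 0) \/ (forall v, v \in P)].

(* The comultiplication H_t |-> H_t (x) H_t, a_i |-> H_i (x) a_i + a_i (x) 1. *)
Definition A1tensor (k : fieldType) (V W : A1data k) : A1data k :=
  @MkA1data k (tensor V W)
    (fun t => tmap (Hact V t) (Hact W t))
    (fun i => tmap (Hact V (val i)) (aact W i) \+ tmap (aact V i) idfun).

Lemma Hact_pure (k : fieldType) (V W : A1data k) t (v : V) (w : W) :
  Hact (A1tensor V W) t (pure v w) = pure (Hact V t v) (Hact W t w).
Proof. exact: tmapE. Qed.

Lemma aact_pure (k : fieldType) (V W : A1data k) i (v : V) (w : W) :
  aact (A1tensor V W) i (pure v w) =
    pure (Hact V (val i) v) (aact W i w) + pure (aact V i v) w.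
Proof. by rewrite /= !tmapE. Qed.

Lemma A1tensor_module (k : fieldType) (V W : A1data k) :
  is_A1module V -> is_A1module W -> is_A1module (A1tensor V W).
Proof.
move=> mV mW.
pose T := A1tensor V W.
have ext (f g : {linear T -> T}) :
    (forall v w, f (pure v w) = g (pure v w)) -> f =1 g by exact: tensor_ext.
have pDl (w : W) (x y : V) : pure (x + y) w = pure x w + pure y w.
  by rewrite linearDl.
have pDr (v : V) (x y : W) : pure v (x + y) = pure v x + pure v y.
  by rewrite linearDr.
have pNl (w : W) (x : V) : pure (- x) w = - pure x w by rewrite linearNl.
have pNr (v : V) (x : W) : pure v (- x) = - pure v x by rewrite linearNr.
have p0l (w : W) : pure (0 : V) w = 0 by rewrite linear0l.
have p0r (v : V) : pure v (0 : W) = 0 by rewrite linear0r.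
have aH (U : A1data k) (mU : is_A1module U) (i j l : transposition) (u : U) :
    val l = (val j ^ val i)%g ->
    Hact U (val i) (aact U j u) = - aact U l (Hact U (val i) u).
  move=> e; rewrite (A1_Ha mU _ e).
  suff -> : odd_perm (val i) by rewrite expr1 scaleN1r.
  case: i {e} => /= s /existsP[x /existsP[y /andP[xy /eqP->]]].
  by rewrite odd_tperm.
have e121 : val t12 = (val t12 ^ val t12)%g by rewrite conjgE mulKg.
have tp x y s : (tperm x y ^ s)%g = tperm (s x : 'I_3) (s y) by exact: tpermJ.
have e1 : val t13 = (val t23 ^ val t12)%g.
  by rewrite /= tp !permE /= .
have e2 : val t12 = (val t13 ^ val t23)%g.
  by rewrite /= tp !permE /= .
have e3 : val t23 = (val t12 ^ val t13)%g.
  by rewrite /= tp !permE /= tpermC.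
have H3 (U : A1data k) (mU : is_A1module U) (u : U) :
  Hact U (val t23) (Hact U (val t13) u) = Hact U (val t12) (Hact U (val t23) u)
  /\ Hact U (val t13) (Hact U (val t12) u)
     = Hact U (val t12) (Hact U (val t23) u).
  rewrite !(A1_HM mU); split; congr (Hact U _ u); apply/permP => x;
  by rewrite !permM !permE; case: x => [[|[|[|//]]] ?]; apply/val_inj => /=; rewrite ?permE.
split.
- apply: (ext (Hact T 1%g) idfun) => v w.
  by rewrite Hact_pure (A1_H1 mV) (A1_H1 mW).
- move=> t s; apply: (ext (Hact T t \o Hact T s) (Hact T (s * t)%g)) => v w.
  by rewrite [LHS]/= -!/(Hact _ _ _) !tmapE (A1_HM mV) (A1_HM mW) -tmapE.
- move=> t i j v e.
  apply: (ext (Hact T t \o aact T i) (((-1) ^+ odd_perm t) \*: (aact T j \o Hact T t))) => {}v w.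
  rewrite [LHS]/= [RHS]/= !tmapE linearD /= !tmapE.
  have eH : Hact V t (Hact V (val i) v) = Hact V (val j) (Hact V t v).
    by rewrite !(A1_HM mV) e conjgE !mulgA mulgV mul1g.
  rewrite (A1_Ha mW _ e) (A1_Ha mV _ e) eH.
  by rewrite linearZr_LR linearZl_LR -scalerDr.
- apply: (ext (aact T t12 \o aact T t12) \0) => v w.
  rewrite [LHS]/= !tmapE !linearD /= !tmapE (A1_a12 mV) (A1_a12 mW).
  by rewrite p0l p0r (aH _ mV _ _ _ _ e121) pNl add0r addr0 addrC subrr.
- apply: (ext ((aact T t12 \o aact T t23) \+ (aact T t23 \o aact T t13)
               \+ (aact T t13 \o aact T t12))
              (idfun \- (Hact T (val t12) \o Hact T (val t23)))) => v w.
  rewrite [LHS]/= [RHS]/= !tmapE !linearD /= !tmapE.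
  have [h1 h2] := H3 _ mV v.
  have [g1 g2] := H3 _ mW w.
  rewrite h1 h2 (aH _ mV _ _ _ _ e1) (aH _ mV _ _ _ _ e2) (aH _ mV _ _ _ _ e3).
  rewrite !pNl.
  set A := Hact V _ (Hact V _ v); set B := Hact W _ (Hact W _ w).
  have qV := A1_aa mV v; have qW := A1_aa mW w.
  have abel (x y z p1 p2 p3 q1 q2 q3 : T) :
      p1 - x + (y + q1) + (p2 - y + (z + q2)) + (p3 - z + (x + q3))
      = (p1 + p2 + p3) + (q1 + q2 + q3).
    rewrite [LHS](AC ((2*2)*(2*2)*(2*2))
                     ((1*5*9)*(4*8*12)*(11*2)*(3*6)*(7*10)))/=.
    by rewrite !subrr !addr0.
  rewrite abel -!pDr -!pDl qV qW -/A -/B pDl pDr pNl pNr.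
  by rewrite addrC -addrA (addrA (- _)) addNr add0r.
Qed.

(* The module on column vectors where H_t acts by [rho t] and a_12 by [A]; the
   actions of a_13 and a_23 are then forced. *)
Definition A1mx (k : fieldType) (n : nat) (rho : 'S_3 -> 'M[k]_n) (A : 'M[k]_n) :
    A1data k :=
  @MkA1data k 'cV[k]_n
    (fun t => mulmx (rho t))
    (fun i => mulmx
       (if i == t12 then A
        else if i == t13 then - (rho (val t23) *m A *m rho (val t23))
        else - (rho (val t13) *m A *m rho (val t13)))).

(* The matrix whose columns are listed in [c]. *)
Definition mx_of_cols (k : fieldType) (n : nat) (c : seq (seq k)) : 'M[k]_n :=
  \matrix_(i, j) (nth [::] c j)`_i.

Definition triv_mx (k : fieldType) (t : 'S_3) : 'M[k]_1 := 1%:M.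
Definition sgn_mx (k : fieldType) (t : 'S_3) : 'M[k]_1 := ((-1) ^+ odd_perm t)%:M.

(* The standard representation in the basis v = e_1 - e_3, w = e_2 - e_3 of the
   sum-zero vectors of the permutation representation k e_1 + k e_2 + k e_3;
   see [std_mx12], [std_mx23] and [std_mx13]. *)
Definition std_mx (k : fieldType) (t : 'S_3) : 'M[k]_2 :=
  \matrix_(i, j) ((t (widen_ord (leqnSn 2) j) == widen_ord (leqnSn 2) i)%:R
                  - (t l3 == widen_ord (leqnSn 2) i)%:R).

Lemma std_mx12 (k : fieldType) :
  std_mx k (val t12) = mx_of_cols 2 [:: [:: 0; 1]; [:: 1; 0]].
Proof.
apply/matrixP => i j; rewrite !mxE !permE /=.
by case: i => [[|[|//]] ?]; case: j => [[|[|//]] ?]; rewrite /= ?(subr0, subrr, sub0r).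
Qed.

Lemma std_mx23 (k : fieldType) :
  std_mx k (val t23) = mx_of_cols 2 [:: [:: 1; -1]; [:: 0; -1]].
Proof.
apply/matrixP => i j; rewrite !mxE !permE /=.
by case: i => [[|[|//]] ?]; case: j => [[|[|//]] ?]; rewrite /= ?(subr0, subrr, sub0r).
Qed.

Lemma std_mx13 (k : fieldType) :
  std_mx k (val t13) = mx_of_cols 2 [:: [:: -1; 0]; [:: -1; 1]].
Proof.
apply/matrixP => i j; rewrite !mxE !permE /=.
by case: i => [[|[|//]] ?]; case: j => [[|[|//]] ?]; rewrite /= ?(subr0, subrr, sub0r).
Qed.

Definition S_eps (k : fieldType) : A1data k := A1mx (@triv_mx k) 0.
Definition S_sgn (k : fieldType) : A1data k := A1mx (@sgn_mx k) 0.

(* The set {i, -i, i/3, -i/3}, where i = sqrt(-1). *)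
Inductive theta := PosI | NegI | PosI3 | NegI3.

(* The rational s such that the element is (i s). *)
Definition th_im (h : theta) : rat :=
  match h with PosI => 1 | NegI => -1 | PosI3 => 1 / 3 | NegI3 => - (1 / 3) end.

Definition sg (h : theta) : rat := Num.sg (th_im h).
Definition absth (h : theta) : rat := `|th_im h|.

(* In the next definitions [ii] is the chosen square root of -1 in k. *)

Definition th_val (k : fieldType) (ii : k) (h : theta) : k :=
  match h with
  | PosI => ii | NegI => - ii | PosI3 => ii / 3 | NegI3 => - (ii / 3)
  end.

Definition S_st (k : fieldType) (ii : k) (h : theta) : A1data k :=
  let c := th_val ii h in
  A1mx (@std_mx k)
    (mx_of_cols 2
       match h with
       | PosI | NegI => [:: [:: c; - c]; [:: c; - c]]
       | PosI3 | NegI3 => [:: [:: c; c]; [:: - c; - c]]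
       end).

Definition M_mx (k : fieldType) (t : 'S_3) : 'M[k]_(1 + 1 + 2) :=
  block_mx (block_mx (triv_mx k t) 0 0 (sgn_mx k t)) 0 0 (std_mx k t).

(* [M ii al be ga et a b h] is M(al, be, ga, et, a, b)[h], in the basis
   x, y, v, w. *)
Definition M (k : fieldType) (ii : k) (al be ga et a b : k) (h : theta) :
    A1data k :=
  let c := th_val ii h in
  let d := match h with PosI | NegI => - c | PosI3 | NegI3 => c end in
  A1mx (@M_mx k)
    (mx_of_cols (1 + 1 + 2) [:: [:: 0; al; be; - be];
                                [:: ga; 0; et; et];
                                [:: a; b; c; d];
                                [:: - a; b; - d; - c]]).

(* Main.v *)
(** Parts (2)-(4) reduce to finite matrix identities: a tensor product of modules
    on column vectors is the space of matrices with [H_t] acting by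
    [X |-> rho t * X * (sigma t)^T], and an isomorphism only has to be checked on
    the generators [H_12], [H_23] and [a_12].  The isomorphisms are forced by
    S_3-equivariance up to scalars: [sgn (x) st = st] through [sgn_twist], and
    [st (x) st = triv + sgn + st], where only the relative scalars of the three
    components depend on the parameters. *)
From HB Require Import structures.
Require Import Defs.
From mathcomp Require Import all_boot all_order all_algebra all_fingroup.
From mathcomp Require Import sesquilinear ring.

Set Implicit Arguments.
Unset Strict Implicit.
Unset Printing Implicit Defensive.

Import GRing.Theory.
Local Open Scope ring_scope.

(** * The transpositions of S_3 and generation of S_3 by (12) and (23) *)

Lemma ord3_ind (P : 'I_3 -> Prop) : P l1 -> P l2 -> P l3 -> forall i, P i.
Proof.
by move=> P1 P2 P3 [[|[|[|//]]] lti3];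
  [move: P1 | move: P2 | move: P3]; congr P; apply: val_inj.
Qed.

Lemma transposition_ind (P : transposition -> Prop) :
  P t12 -> P t13 -> P t23 -> forall i, P i.
Proof.
move=> P12 P13 P23 i.
suff: [\/ i = t12, i = t13 | i = t23] by case=> ->.
have: exists x y : 'I_3, x != y /\ val i = tperm x y.
  case: i => s /= /existsP[x /existsP[y /andP[xy /eqP->]]].
  by exists x, y.
move=> [x [y [+ ei]]].
suff: x != y ->
    [\/ tperm x y = val t12, tperm x y = val t13 | tperm x y = val t23].
  move=> h /h; rewrite -ei; case=> /val_inj->;
    by [constructor 1 | constructor 2 | constructor 3].
move: x y {i ei}; apply: ord3_ind; apply: ord3_ind => // _.
all: try by [constructor 1 | constructor 2 | constructor 3].
all: rewrite tpermC.
all: try by [constructor 1 | constructor 2 | constructor 3].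
Qed.

Lemma val_t13 : val t13 = (val t12 * val t23 * val t12)%g.
Proof. by apply/permP; apply: ord3_ind; rewrite !permM !permE. Qed.

(** Every permutation is a product of transpositions, and (13) = (12)(23)(12). Closure under
    inverses is not asked for, since the generators are involutions. *)
Lemma S3_ind (P : 'S_3 -> Prop) :
  P 1%g -> P (val t12) -> P (val t23) ->
  (forall s t, P s -> P t -> P (s * t)%g) -> forall t, P t.
Proof.
move=> P1 P12 P23 PM t; have [ts -> _] := prod_tpermP t.
have P13 : P (val t13) by rewrite val_t13; exact: PM (PM _ _ P12 P23) P12.
apply: big_ind => // -[i j] _ /=; move: i j.
by apply: ord3_ind; apply: ord3_ind; rewrite ?tperm1 // tpermC.
Qed.

Lemma conj_t12_t23 : val t13 = (val t12 ^ val t23)%g.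
Proof. by rewrite tpermJ !permE. Qed.

Lemma conj_t12_t13 : val t23 = (val t12 ^ val t13)%g.
Proof. by rewrite tpermJ !permE tpermC. Qed.

Lemma odd_transposition (i : transposition) : odd_perm (val i).
Proof. by move: i; apply: transposition_ind; rewrite odd_tperm. Qed.

Lemma transposition_mulgg (i : transposition) : (val i * val i = 1)%g.
Proof. by move: i; apply: transposition_ind; rewrite tperm2. Qed.

(** Supplies the intermediate index when the relation between [H_t] and [a_i] is proved for a
    product of two permutations. *)
Lemma is_transpositionJ (i : transposition) (t : 'S_3) :
  {j : transposition | val j = (val i ^ t)%g}.
Proof.
suff h : is_transposition (val i ^ t).
  by exists (exist (fun s : 'S_3 => is_transposition s) _ h).
case: i => s /= /existsP[x /existsP[y /andP[xy /eqP->]]].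
by rewrite tpermJ tperm_is_transposition // (inj_eq perm_inj).
Qed.

Lemma t13_neq_t12 : t13 != t12.
Proof. by apply/eqP=> /(congr1 val)/permP/(_ l1); rewrite !permE. Qed.

Lemma t23_neq_t12 : t23 != t12.
Proof. by apply/eqP=> /(congr1 val)/permP/(_ l1); rewrite !permE. Qed.

Lemma t23_neq_t13 : t23 != t13.
Proof. by apply/eqP=> /(congr1 val)/permP/(_ l1); rewrite !permE. Qed.

(** * Isomorphisms of modules and modules given by matrices *)

Section Modules.
Variable k : fieldType.
Implicit Types (U V W : A1data k) (n m p : nat).

(** Spares the verification of the relations in the modules [M]: they are inherited from the tensor
    product through the isomorphism. *)
Lemma A1module_transport V W (f : {linear V -> W}) :
  is_A1module V -> bijective f ->
  (forall t v, f (Hact V t v) = Hact W t (f v)) ->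
  (forall i v, f (aact V i v) = aact W i (f v)) ->
  is_A1module W.
Proof.
move=> mV [g fK gK] fH fa; split.
- by move=> w; rewrite -[w]gK -fH (A1_H1 mV).
- by move=> t s w; rewrite -[w]gK -!fH (A1_HM mV).
- by move=> t i j w e; rewrite -[w]gK -!(fH, fa) (A1_Ha mV _ e) linearZ.
- by move=> w; rewrite -[w]gK -!fa (A1_a12 mV) linear0.
- by move=> w; rewrite -[w]gK -!(fH, fa) -!linearD (A1_aa mV) linearB.
Qed.

Lemma A1iso_sym V W : A1iso V W -> A1iso W V.
Proof.
case=> mV mW [f [[g fK gK] fH fa]]; split=> //.
have g_lin : linear g by apply: can2_linear fK gK.
pose gl := GRing.isLinear.Build k W V _ g g_lin.
pose G : {linear W -> V} := HB.pack g gl.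
exists G; split; first by exists f.
- by move=> t w; apply: (can_inj fK); rewrite fH /= !gK.
- by move=> i w; apply: (can_inj fK); rewrite fa /= !gK.
Qed.

Lemma A1iso_trans V W U : A1iso V W -> A1iso W U -> A1iso V U.
Proof.
case=> mV mW [f [bf fH fa]] [_ mU [g [bg gH ga]]]; split=> //.
exists (g \o f); split; first exact: bij_comp.
- by move=> t v; rewrite /= fH gH.
- by move=> i v; rewrite /= fa ga.
Qed.

(** A name for the matrix of [a_i] inside [A1mx], so that the case distinction can be folded and
    rewritten. *)
Definition a_mx n (rho : 'S_3 -> 'M[k]_n) (A : 'M[k]_n) (i : transposition) :=
  if i == t12 then A
  else if i == t13 then - (rho (val t23) *m A *m rho (val t23))
  else - (rho (val t13) *m A *m rho (val t13)).

Lemma a_mx12 n rho (A : 'M[k]_n) : a_mx rho A t12 = A.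
Proof. by rewrite /a_mx eqxx. Qed.

Lemma a_mx13 n rho (A : 'M[k]_n) :
  a_mx rho A t13 = - (rho (val t23) *m A *m rho (val t23)).
Proof. by rewrite /a_mx (negbTE t13_neq_t12) eqxx. Qed.

Lemma a_mx23 n rho (A : 'M[k]_n) :
  a_mx rho A t23 = - (rho (val t13) *m A *m rho (val t13)).
Proof. by rewrite /a_mx (negbTE t23_neq_t12) (negbTE t23_neq_t13). Qed.

Definition a_mxE := (a_mx12, a_mx13, a_mx23).

Definition is_rep n (rho : 'S_3 -> 'M[k]_n) : Prop :=
  rho 1%g = 1%:M /\ forall t s, rho t *m rho s = rho (s * t)%g.

Lemma Hact_aact V (i j : transposition) (t : transposition) (v : V) :
  is_A1module V -> val j = (val i ^ val t)%g ->
  Hact V (val t) (aact V i v) = - aact V j (Hact V (val t) v).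
Proof.
by move=> mV e; rewrite (A1_Ha mV _ e) odd_transposition expr1 scaleN1r.
Qed.

(** The reason for the formulas for [a_13] and [a_23] in [A1mx]: in any module they are the negated
    conjugates of [a_12] under (23) and (13). *)
Lemma aact_conj V (i j : transposition) (t : transposition) (v : V) :
  is_A1module V -> val j = (val i ^ val t)%g ->
  aact V j v = - Hact V (val t) (aact V i (Hact V (val t) v)).
Proof.
move=> mV e; rewrite (Hact_aact _ mV e) opprK (A1_HM mV).
by rewrite transposition_mulgg (A1_H1 mV).
Qed.

(** Compatibility with [H_12] and [H_23] spreads to all of S_3 because both sides are
    multiplicative. Compatibility with [a_13] and [a_23] then follows, as in both modules they are
    the same conjugates of [a_12]. *)
Lemma A1iso_A1mx V n (rho : 'S_3 -> 'M[k]_n) (A : 'M[k]_n)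
    (f : {linear V -> 'cV[k]_n}) :
  is_A1module V -> is_rep rho -> bijective f ->
  (forall v, f (Hact V (val t12) v) = rho (val t12) *m f v) ->
  (forall v, f (Hact V (val t23) v) = rho (val t23) *m f v) ->
  (forall v, f (aact V t12 v) = A *m f v) ->
  A1iso V (A1mx rho A).
Proof.
move=> mV [rho1 rhoM] bf f12 f23 fA.
have fH t v : f (Hact V t v) = rho t *m f v.
  elim/S3_ind: t v => [v|//|//|s t fs ft v].
    by rewrite (A1_H1 mV) rho1 mul1mx.
  by rewrite -(A1_HM mV) ft fs mulmxA rhoM.
have fa i v : f (aact V i v) = aact (A1mx rho A) i (f v).
  rewrite /= -[f _]/(f _) -/(a_mx rho A i).
  elim/transposition_ind: i; rewrite a_mxE.
  - exact: fA.
  - rewrite (aact_conj _ mV conj_t12_t23).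
    by rewrite linearN fH fA fH mulNmx !mulmxA.
  - rewrite (aact_conj _ mV conj_t12_t13).
    by rewrite linearN fH fA fH mulNmx !mulmxA.
split=> //; last by exists f.
exact: (@A1module_transport V (A1mx rho A) f).
Qed.

(** Of the relations between [H_t] and [a_i], only the anticommutation of [H_12] with [a_12] has to
    be assumed. The others for [t] = (12), (23) follow from it and the definition of [a_13] and
    [a_23], and the sign is multiplicative in [t]. *)
Lemma A1mx_module n (rho : 'S_3 -> 'M[k]_n) (A : 'M[k]_n) :
  is_rep rho ->
  rho (val t12) *m A = - (A *m rho (val t12)) ->
  A *m A = 0 ->
  A *m a_mx rho A t23 + a_mx rho A t23 *m a_mx rho A t13 + a_mx rho A t13 *m A
    = 1%:M - rho (val t12) *m rho (val t23) ->
  is_A1module (A1mx rho A).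
Proof.
move=> [rho1 rhoM] A12 AA aa.
pose a := a_mx rho A.
have rhoK (i : transposition) : rho (val i) *m rho (val i) = 1%:M.
  by rewrite rhoM transposition_mulgg rho1.
have r1 : rho (val t12) *m rho (val t23) = rho (val t13) *m rho (val t12).
  by rewrite !rhoM; congr rho; apply/permP; apply: ord3_ind; rewrite !permM !permE.
have r2 : rho (val t12) *m rho (val t13) = rho (val t23) *m rho (val t12).
  by rewrite !rhoM; congr rho; apply/permP; apply: ord3_ind; rewrite !permM !permE.
have r3 : rho (val t23) *m rho (val t13) = rho (val t13) *m rho (val t12).
  by rewrite !rhoM; congr rho; apply/permP; apply: ord3_ind; rewrite !permM !permE.
have r4 : rho (val t13) *m rho (val t23) = rho (val t12) *m rho (val t13).
  by rewrite !rhoM; congr rho; apply/permP; apply: ord3_ind; rewrite !permM !permE.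
have Ha t : forall i j, val j = (val i ^ t)%g ->
    rho t *m a i = (-1) ^+ odd_perm t *: (a j *m rho t).
  elim/S3_ind: t.
  - move=> i j; rewrite conjg1 => /val_inj->.
    by rewrite odd_perm1 scale1r rho1 mul1mx mulmx1.
  (* Conjugation by (12) fixes (12), which is the hypothesis [A12], and exchanges (13) and (23):
     there [rho (val t12)] is moved past [A] by [A12]. *)
  - rewrite odd_tperm expr1 => i j; rewrite scaleN1r.
    elim/transposition_ind: i; rewrite tpermJ !permE.
    + move=> e; have -> : j = t12 by apply: val_inj; rewrite e tpermC.
      by rewrite /a a_mxE A12.
    + move=> e; have -> : j = t23 by apply: val_inj; rewrite e.
      rewrite /a !a_mxE mulNmx opprK mulmxN !mulmxA r1.
      rewrite -(mulmxA _ (rho _) A) A12 mulmxN mulNmx opprK.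
      by rewrite -!mulmxA r1.
    + move=> e; have -> : j = t13 by apply: val_inj; rewrite e.
      rewrite /a !a_mxE mulNmx opprK mulmxN !mulmxA r2.
      rewrite -(mulmxA _ (rho _) A) A12 mulmxN mulNmx opprK.
      by rewrite -!mulmxA r2.
  (* Conjugation by (23) exchanges (12) and (13), which holds by the definition of [a_13], and fixes
     (23), where [A12] is needed again. *)
  - rewrite odd_tperm expr1 => i j; rewrite scaleN1r.
    elim/transposition_ind: i; rewrite tpermJ !permE.
    + move=> e; have -> : j = t13 by apply: val_inj; rewrite e.
      by rewrite /a !a_mxE mulNmx opprK -!mulmxA rhoK mulmx1.
    + move=> e; have -> : j = t12 by apply: val_inj; rewrite e.
      by rewrite /a !a_mxE mulmxN !mulmxA rhoK mul1mx.
    + move=> e; have -> : j = t23 by apply: val_inj; rewrite e tpermC.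
      rewrite /a !a_mxE mulNmx opprK mulmxN !mulmxA r3.
      rewrite -(mulmxA _ (rho _) A) A12 mulmxN mulNmx opprK.
      by rewrite -!mulmxA r4.
  - move=> s t IHs IHt i j e.
    have [l el] := is_transpositionJ i s.
    have ej : val j = (val l ^ t)%g by rewrite el e conjgM.
    rewrite -rhoM -[LHS]mulmxA (IHs _ _ el) -scalemxAr.
    rewrite [rho t *m (_ *m _)]mulmxA (IHt _ _ ej) -scalemxAl scalerA.
    by rewrite odd_permM signr_addb mulmxA.
split=> /= [v|t s v|t i j v e|v|v].
- by rewrite rho1 mul1mx.
- by rewrite mulmxA rhoM.
- by rewrite -!/(a_mx _ _ _) mulmxA (Ha _ _ _ e) -scalemxAl mulmxA.
- by rewrite -!/(a_mx _ _ _) a_mxE mulmxA AA mul0mx.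
- rewrite -!/(a_mx _ _ _) a_mx12 !mulmxA -!mulmxDl.
  by rewrite aa mulmxBl mul1mx.
Qed.

Lemma triv_rep : is_rep (@triv_mx k).
Proof. by split=> // t s; rewrite /triv_mx mulmx1. Qed.

Lemma sgn_rep : is_rep (@sgn_mx k).
Proof.
split=> [|t s]; first by rewrite /sgn_mx odd_perm1.
by rewrite /sgn_mx -scalar_mxM odd_permM signr_addb mulrC.
Qed.

Lemma widen_ord_neq_l3 (i : 'I_2) : (l3 == widen_ord (leqnSn 2) i) = false.
Proof. by case: i => [[|[|//]] ?]. Qed.

Lemma std_rep : is_rep (@std_mx k).
Proof.
split=> [|t s]; apply/matrixP=> i j; rewrite !mxE.
  rewrite !perm1 widen_ord_neq_l3 subr0 eq_sym.
  by congr (_%:R); congr nat_of_bool; apply/idP/idP => /eqP e; apply/eqP;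
    apply: val_inj; have:= congr1 val e.
set e := widen_ord _.
(* The sum over two indices is extended to all three letters: the new term, at [l3], has first
   factor zero. The indicators in the second factor then pick out [s (e j)] and [s l3], and the two
   copies of the [t l3] term cancel. *)
transitivity (\sum_(x : 'I_3) ((t x == e i)%:R - (t l3 == e i)%:R : k)
                   * ((s (e j) == x)%:R - (s l3 == x)%:R)).
  rewrite [RHS]big_ord_recr /= [X in _ + X](_ : _ = 0).
    by rewrite addr0; apply: eq_bigr => x _; rewrite !mxE.
  by rewrite (_ : ord_max = l3) ?subrr ?mul0r //; apply: val_inj.
have pick (y : 'I_3) (F : 'I_3 -> k) : \sum_x F x * (y == x)%:R = F y.
  rewrite (bigD1 y) //= eqxx mulr1 big1 ?addr0 // => x /negbTE.
  by rewrite eq_sym => ->; rewrite mulr0.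
under eq_bigr do rewrite mulrBr.
rewrite sumrB !pick !permM; ring.
Qed.

Lemma block_rep n m rho sigma : @is_rep n rho -> @is_rep m sigma ->
  is_rep (fun t => block_mx (rho t) 0 0 (sigma t)).
Proof.
move=> [rho1 rhoM] [sigma1 sigmaM]; split=> [|t s].
  by rewrite rho1 sigma1 -scalar_mx_block.
by rewrite mulmx_block !(mulmx0, mul0mx, addr0, add0r) rhoM sigmaM.
Qed.

Lemma M_rep : is_rep (@M_mx k).
Proof. exact: (block_rep (block_rep triv_rep sgn_rep) std_rep). Qed.

Lemma S_eps_module : is_A1module (S_eps k).
Proof.
apply: A1mx_module; rewrite ?a_mxE ?(mulmx0, mul0mx, oppr0) //.
  exact: triv_rep.
by rewrite !(mulmx0, mul0mx, addr0) mulmx1 subrr.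
Qed.

(** With all [a_i] zero, the last relation says that [H_12 H_23] acts as the identity, and a product
    of two transpositions is even. *)
Lemma S_sgn_module : is_A1module (S_sgn k).
Proof.
apply: A1mx_module; rewrite ?a_mxE ?(mulmx0, mul0mx, oppr0) //.
  exact: sgn_rep.
rewrite !(mulmx0, mul0mx, addr0) sgn_rep.2 /sgn_mx.
by rewrite odd_permM !odd_tperm subrr.
Qed.

End Modules.

(** * Tensor products of modules on column vectors, realized as spaces of matrices *)

Lemma pureZl (k : fieldType) (V W : lmodType k) a (v : V) (w : W) :
  pure (a *: v) w = a *: pure v w.
Proof. exact: linearZl_LR. Qed.

Lemma pureZr (k : fieldType) (V W : lmodType k) a (v : V) (w : W) :
  pure v (a *: w) = a *: pure v w.
Proof. exact: linearZr_LR. Qed.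

Section TensorMx.
Variables (k : fieldType) (n m : nat).
Implicit Types (v : 'cV[k]_n) (w : 'cV[k]_m) (X : 'M[k]_(n, m)).

Definition outer v w : 'M[k]_(n, m) := v *m w^T.

Lemma outer_bilinear : bilinear_for *:%R *:%R outer.
Proof.
split=> [w | v] a x y; rewrite /outer; first by rewrite mulmxDl -scalemxAl.
by rewrite linearP /= mulmxDr -scalemxAr.
Qed.

HB.instance Definition _ :=
  bilinear_isBilinear.Build k 'cV[k]_n 'cV[k]_m 'M[k]_(n, m) *:%R *:%R
    outer outer_bilinear.

Definition tensor_to_mx : {linear tensor 'cV[k]_n 'cV[k]_m -> 'M[k]_(n, m)} :=
  tlift outer.

Lemma tensor_to_mx_pure v w : tensor_to_mx (pure v w) = v *m w^T.
Proof. exact: tlift_pure. Qed.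

Definition tensor_of_mx X : tensor 'cV[k]_n 'cV[k]_m :=
  \sum_i \sum_j X i j *: pure (delta_mx i 0) (delta_mx j 0).

Lemma tensor_of_mx_linear : linear tensor_of_mx.
Proof.
move=> a X Y; rewrite /tensor_of_mx scaler_sumr -big_split; apply: eq_bigr => i _.
rewrite scaler_sumr -big_split; apply: eq_bigr => j _ /=.
by rewrite !mxE scalerDl -scalerA.
Qed.

HB.instance Definition _ :=
  GRing.isLinear.Build k _ _ _ tensor_of_mx tensor_of_mx_linear.

Lemma tensor_to_mxK : cancel tensor_to_mx tensor_of_mx.
Proof.
apply: (tensor_ext (f := tensor_of_mx \o tensor_to_mx) (g := idfun)) => v w.
rewrite /= tensor_to_mx_pure.
(* Both factors are expanded in the standard bases; the coefficients [v_i w_j] are the entries of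
   [v *m w^T]. *)
have colE l (u : 'cV[k]_l) : u = \sum_i u i 0 *: delta_mx i 0.
  by rewrite {1}[u]matrix_sum_delta; apply: eq_bigr => i _; rewrite big_ord1.
rewrite {2}(colE _ v) linear_sumlz; apply: eq_bigr => i _ /=.
rewrite {2}(colE _ w) linear_sumr; apply: eq_bigr => j _ /=.
by rewrite pureZl pureZr scalerA !mxE big_ord1 !mxE.
Qed.

Lemma tensor_of_mxK : cancel tensor_of_mx tensor_to_mx.
Proof.
move=> X; rewrite [RHS]matrix_sum_delta linear_sum; apply: eq_bigr => i _.
rewrite linear_sum; apply: eq_bigr => j _.
rewrite linearZ /= tensor_to_mx_pure trmx_delta mul_delta_mx //.
Qed.

(** Under [v (x) w |-> v *m w^T], the coproduct [H_12 (x) a_12 + a_12 (x) 1] becomes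
    [X |-> rho (val t12) *m X *m B^T + A *m X]. Each compatibility is checked on pure tensors. *)
Lemma A1iso_tensor_mx p (rho : 'S_3 -> 'M[k]_n) (A : 'M[k]_n)
    (sigma : 'S_3 -> 'M[k]_m) (B : 'M[k]_m) (tau : 'S_3 -> 'M[k]_p) (C : 'M[k]_p)
    (f : {linear 'M[k]_(n, m) -> 'cV[k]_p}) :
  is_A1module (A1mx rho A) -> is_A1module (A1mx sigma B) ->
  is_rep tau -> bijective f ->
  (forall X, f (rho (val t12) *m X *m (sigma (val t12))^T) = tau (val t12) *m f X) ->
  (forall X, f (rho (val t23) *m X *m (sigma (val t23))^T) = tau (val t23) *m f X) ->
  (forall X, f (rho (val t12) *m X *m B^T + A *m X) = C *m f X) ->
  A1iso (A1tensor (A1mx rho A) (A1mx sigma B)) (A1mx tau C).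
Proof.
move=> mV mW tau_rep bf f12 f23 fa.
set T := A1tensor _ _.
have bF : bijective (f \o tensor_to_mx).
  by apply: bij_comp => //; exists tensor_of_mx;
    [exact: tensor_to_mxK | exact: tensor_of_mxK].
have ext (F G : {linear T -> 'cV[k]_p}) :
    (forall v w, F (pure v w) = G (pure v w)) -> F =1 G by exact: tensor_ext.
apply: (@A1iso_A1mx _ T _ _ _ (f \o tensor_to_mx)) => //.
- exact: A1tensor_module.
- apply: (ext ((f \o tensor_to_mx) \o Hact T (val t12))
    (mulmx (tau (val t12)) \o (f \o tensor_to_mx))) => v w.
  rewrite [LHS]/= [RHS]/= tmapE !tensor_to_mx_pure -f12.
  by rewrite trmx_mul !mulmxA.
- apply: (ext ((f \o tensor_to_mx) \o Hact T (val t23))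
    (mulmx (tau (val t23)) \o (f \o tensor_to_mx))) => v w.
  rewrite [LHS]/= [RHS]/= tmapE !tensor_to_mx_pure -f23.
  by rewrite trmx_mul !mulmxA.
- apply: (ext ((f \o tensor_to_mx) \o aact T t12)
    (mulmx C \o (f \o tensor_to_mx))) => v w.
  rewrite [LHS]/= [RHS]/= !tmapE.
  rewrite [tensor_to_mx _]linearD !tensor_to_mx_pure -fa.
  by rewrite -!/(a_mx _ _ _) !a_mx12 trmx_mul !mulmxA.
Qed.

End TensorMx.

(** * Tensoring with the trivial module *)

Section Unit.
Variables (k : fieldType) (V : lmodType k).

Definition unit_l (s : 'cV[k]_1) (v : V) : V := s 0 0 *: v.
Definition unit_r (v : V) (s : 'cV[k]_1) : V := s 0 0 *: v.

Lemma unit_l_bilinear : bilinear_for *:%R *:%R unit_l.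
Proof.
split=> [w | v] a x y; rewrite /unit_l; first by rewrite !mxE scalerDl -scalerA.
by rewrite scalerDr; congr (_ + _); rewrite [LHS]scalerA mulrC -scalerA.
Qed.

Lemma unit_r_bilinear : bilinear_for *:%R *:%R unit_r.
Proof.
split=> [w | v] a x y; rewrite /unit_r; last by rewrite !mxE scalerDl -scalerA.
by rewrite scalerDr; congr (_ + _); rewrite [LHS]scalerA mulrC -scalerA.
Qed.

HB.instance Definition _ :=
  bilinear_isBilinear.Build k 'cV[k]_1 V V *:%R *:%R unit_l unit_l_bilinear.
HB.instance Definition _ :=
  bilinear_isBilinear.Build k V 'cV[k]_1 V *:%R *:%R unit_r unit_r_bilinear.

Lemma cV1_scale (s : 'cV[k]_1) : s = s 0 0 *: 1%:M.
Proof. by rewrite scale_scalar_mx mulr1 [LHS]mx11_scalar. Qed.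

Lemma tlift_unit_l_bij : bijective (tlift unit_l).
Proof.
exists (fun v => pure 1%:M v) => [|v]; last first.
  by rewrite tlift_pure /= /unit_l mxE eqxx scale1r.
have pure1_linear : linear (fun v : V => pure (1%:M : 'cV[k]_1) v).
  by move=> a u v; rewrite linearPr.
pose pure1 : {linear V -> tensor 'cV[k]_1 V} :=
  HB.pack (fun v : V => pure (1%:M : 'cV[k]_1) v)
    (GRing.isLinear.Build k _ _ _ _ pure1_linear).
apply: (tensor_ext (f := pure1 \o tlift unit_l) (g := idfun)) => s v.
rewrite [LHS]/= tlift_pure /= pureZr.
by rewrite {2}(cV1_scale s) pureZl.
Qed.

Lemma tlift_unit_r_bij : bijective (tlift unit_r).
Proof.
exists (fun v => pure v 1%:M) => [|v]; last first.
  by rewrite tlift_pure /= /unit_r mxE eqxx scale1r.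
have pure1_linear : linear (fun v : V => pure v (1%:M : 'cV[k]_1)).
  by move=> a u v; rewrite linearPl.
pose pure1 : {linear V -> tensor V 'cV[k]_1} :=
  HB.pack (fun v : V => pure v (1%:M : 'cV[k]_1))
    (GRing.isLinear.Build k _ _ _ _ pure1_linear).
apply: (tensor_ext (f := pure1 \o tlift unit_r) (g := idfun)) => v s.
rewrite [LHS]/= tlift_pure /= pureZl.
by rewrite {2}(cV1_scale s) pureZr.
Qed.

End Unit.

(** Here [a_i (x) 1] vanishes and [H_i (x) a_i] is [1 (x) a_i], so scalar multiplication is an
    isomorphism of modules. On the other side it is [H_i (x) a_i] that vanishes. *)
Lemma S_eps_tensor (k : fieldType) (V : A1data k) :
  is_A1module V -> A1iso (A1tensor (S_eps k) V) V.
Proof.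
move=> mV; split=> //; first exact: A1tensor_module (S_eps_module k) mV.
set T := A1tensor _ _.
have ext (F G : {linear T -> V}) :
    (forall v w, F (pure v w) = G (pure v w)) -> F =1 G by exact: tensor_ext.
exists (tlift (@unit_l k V)); split; first exact: tlift_unit_l_bij.
- move=> t; apply: (ext (tlift (@unit_l k V) \o Hact T t)
                        (Hact V t \o tlift (@unit_l k V))) => s v.
  rewrite [LHS]/= [RHS]/= tmapE !tlift_pure /unit_l /= /triv_mx mul1mx.
  by rewrite linearZ.
- move=> i; apply: (ext (tlift (@unit_l k V) \o aact T i)
                        (aact V i \o tlift (@unit_l k V))) => s v.
  rewrite [LHS]/= [RHS]/= !tmapE [LHS]linearD [LHS]/= !tlift_pure /unit_l /= /triv_mx.
  rewrite !(mul1mx, mulmx0, mul0mx, oppr0, if_same) /unit_l.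
  by rewrite mxE scale0r addr0 linearZ.
Qed.

Lemma tensor_S_eps (k : fieldType) (V : A1data k) :
  is_A1module V -> A1iso (A1tensor V (S_eps k)) V.
Proof.
move=> mV; split=> //; first exact: A1tensor_module mV (S_eps_module k).
set T := A1tensor _ _.
have ext (F G : {linear T -> V}) :
    (forall v w, F (pure v w) = G (pure v w)) -> F =1 G by exact: tensor_ext.
exists (tlift (@unit_r k V)); split; first exact: tlift_unit_r_bij.
- move=> t; apply: (ext (tlift (@unit_r k V) \o Hact T t)
                        (Hact V t \o tlift (@unit_r k V))) => v s.
  rewrite [LHS]/= [RHS]/= tmapE !tlift_pure /unit_r /= /triv_mx mul1mx.
  by rewrite linearZ.
- move=> i; apply: (ext (tlift (@unit_r k V) \o aact T i)
                        (aact V i \o tlift (@unit_r k V))) => v s.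
  rewrite [LHS]/= [RHS]/= !tmapE [LHS]linearD [LHS]/= !tlift_pure /unit_r /= /triv_mx.
  rewrite !(mulmx0, mul0mx, oppr0, if_same) /unit_r.
  by rewrite mxE scale0r add0r linearZ.
Qed.

(** * Explicit matrices of size 2 and 4 *)

Lemma ord2_ind (P : 'I_2 -> Prop) : P ord0 -> P ord_max -> forall i, P i.
Proof.
by move=> P0 P1 [[|[|//]] lti2];
  [move: P0 | move: P1]; congr P; apply: val_inj.
Qed.

(** Indices are written with [lshift] and [rshift] so that the entries of the nested blocks in
    [M_mx] can be computed. *)
Lemma ord4_ind (P : 'I_(1 + 1 + 2) -> Prop) :
  P (lshift 2 (lshift 1 0)) -> P (lshift 2 (rshift 1 0)) ->
  P (rshift (1 + 1) ord0) -> P (rshift (1 + 1) ord_max) -> forall i, P i.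
Proof.
by move=> P0 P1 P2 P3 [[|[|[|[|//]]]] lti4];
  [move: P0 | move: P1 | move: P2 | move: P3]; congr P; apply: val_inj.
Qed.

Section Matrices.
Variable k : fieldType.

(** Entries are listed column by column: [a, b] is the image of the first basis vector. *)
Definition mx2 (a b c d : k) : 'M[k]_2 := mx_of_cols 2 [:: [:: a; b]; [:: c; d]].

Lemma mx2_eta (X : 'M[k]_2) : exists a b c d, X = mx2 a b c d.
Proof.
exists (X ord0 ord0), (X ord_max ord0), (X ord0 ord_max), (X ord_max ord_max).
by apply/matrixP; apply: ord2_ind; apply: ord2_ind; rewrite mxE.
Qed.

Lemma mx2M a b c d a' b' c' d' : mx2 a b c d *m mx2 a' b' c' d' =
  mx2 (a * a' + c * b') (b * a' + d * b') (a * c' + c * d') (b * c' + d * d').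
Proof.
by apply/matrixP; apply: ord2_ind; apply: ord2_ind;
  rewrite !(mxE, big_ord_recl, big_ord0) /= addr0.
Qed.

Lemma mx2D a b c d a' b' c' d' : mx2 a b c d + mx2 a' b' c' d' =
  mx2 (a + a') (b + b') (c + c') (d + d').
Proof. by apply/matrixP; apply: ord2_ind; apply: ord2_ind; rewrite !mxE. Qed.

Lemma mx2N a b c d : - mx2 a b c d = mx2 (- a) (- b) (- c) (- d).
Proof. by apply/matrixP; apply: ord2_ind; apply: ord2_ind; rewrite !mxE. Qed.

Lemma mx2_tr a b c d : (mx2 a b c d)^T = mx2 a c b d.
Proof. by apply/matrixP; apply: ord2_ind; apply: ord2_ind; rewrite !mxE. Qed.

Lemma mx2_scalar a : a%:M = mx2 a 0 0 a.
Proof. by apply/matrixP; apply: ord2_ind; apply: ord2_ind; rewrite !mxE. Qed.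

Lemma mx2_0 : 0 = mx2 0 0 0 0.
Proof. by apply/matrixP; apply: ord2_ind; apply: ord2_ind; rewrite !mxE. Qed.

Definition mx2E := (mx2M, mx2D, mx2N, mx2_tr).

Definition S_st_mx (ii : k) h : 'M[k]_2 :=
  let c := th_val ii h in
  match h with
  | PosI | NegI => mx2 c (- c) c (- c)
  | PosI3 | NegI3 => mx2 c c (- c) (- c)
  end.

Lemma S_stE (ii : k) h : S_st ii h = A1mx (@std_mx k) (S_st_mx ii h).
Proof. by case: h. Qed.

Lemma std_mx12' : std_mx k (val t12) = mx2 0 1 1 0.
Proof. exact: std_mx12. Qed.

Lemma std_mx23' : std_mx k (val t23) = mx2 1 (- 1) 0 (- 1).
Proof. exact: std_mx23. Qed.

Lemma std_mx13' : std_mx k (val t13) = mx2 (- 1) 0 (- 1) 1.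
Proof. exact: std_mx13. Qed.

Definition std_mxE := (std_mx12', std_mx13', std_mx23').

Lemma S_st_module (ii : k) h :
  3%:R != 0 :> k -> ii ^+ 2 = -1 -> is_A1module (S_st ii h).
Proof.
move=> n3 hii; rewrite S_stE; apply: A1mx_module; first exact: std_rep.
- by case: h; rewrite /S_st_mx std_mxE !mx2E; congr mx2; ring.
- by case: h; rewrite /S_st_mx mx2M mx2_0; congr mx2; ring.
(* Only this relation uses [ii ^+ 2 = -1]; the two before it are polynomial identities in the
   parameter. *)
- rewrite !a_mxE !std_mxE mx2_scalar; set c := th_val ii h.
  by case: h @c => c; rewrite /S_st_mx -/c !mx2E; congr mx2;
    rewrite /c /=; field: hii.
Qed.

Definition col4 (x y v w : k) : 'cV[k]_(1 + 1 + 2) := \col_i [:: x; y; v; w]`_i.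

Definition mx4 (c0 c1 c2 c3 : seq k) := mx_of_cols (1 + 1 + 2) [:: c0; c1; c2; c3].

(** On the four-dimensional side all computations are of a matrix applied to a vector, so products
    of two matrices of size 4 never occur. *)
Lemma mx4_col4 c0 c1 c2 c3 x y v w : mx4 c0 c1 c2 c3 *m col4 x y v w =
  let e i := c0`_i * x + c1`_i * y + c2`_i * v + c3`_i * w in
  col4 (e 0%N) (e 1%N) (e 2%N) (e 3%N).
Proof.
apply/colP; apply: ord4_ind; rewrite !(mxE, big_ord_recl, big_ord0) /= !addrA addr0 //.
Qed.

Lemma col4_eta (u : 'cV[k]_(1 + 1 + 2)) : exists x y v w, u = col4 x y v w.
Proof.
exists (u (lshift 2 (lshift 1 0)) 0), (u (lshift 2 (rshift 1 0)) 0),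
  (u (rshift (1 + 1) ord0) 0), (u (rshift (1 + 1) ord_max) 0).
by apply/colP; apply: ord4_ind; rewrite mxE.
Qed.

Lemma M_mx12 : M_mx k (val t12) =
  mx4 [:: 1; 0; 0; 0] [:: 0; -1; 0; 0] [:: 0; 0; 0; 1] [:: 0; 0; 1; 0].
Proof.
apply/matrixP; rewrite /M_mx std_mx12 /sgn_mx odd_tperm.
by apply: ord4_ind; apply: ord4_ind;
  rewrite ?(block_mxEul, block_mxEur, block_mxEdl, block_mxEdr) !mxE ?expr1.
Qed.

Lemma M_mx23 : M_mx k (val t23) =
  mx4 [:: 1; 0; 0; 0] [:: 0; -1; 0; 0] [:: 0; 0; 1; -1] [:: 0; 0; 0; -1].
Proof.
apply/matrixP; rewrite /M_mx std_mx23 /sgn_mx odd_tperm.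
by apply: ord4_ind; apply: ord4_ind;
  rewrite ?(block_mxEul, block_mxEur, block_mxEdl, block_mxEdr) !mxE ?expr1.
Qed.

End Matrices.

(** * Tensoring with the sign module *)

Definition swap_abs h :=
  match h with PosI => PosI3 | NegI => NegI3 | PosI3 => PosI | NegI3 => NegI end.
Definition swap_sg h :=
  match h with PosI => NegI | NegI => PosI | PosI3 => NegI3 | NegI3 => PosI3 end.

Lemma swap_absP h h' : sg h = sg h' -> absth h <> absth h' -> h' = swap_abs h.
Proof.
by case: h h' => [] [] e a;
  first [reflexivity | case: a; reflexivity | vm_compute in e; discriminate e].
Qed.

Lemma sg_swap h : sg (swap_sg h) = - sg h.
Proof. by case: h; vm_compute. Qed.

Lemma absth_swap h : absth (swap_sg h) = absth h.
Proof. by case: h; vm_compute. Qed.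

Section Sgn.
Variables (k : fieldType) (ii : k).
Hypotheses (n3 : 3%:R != 0 :> k) (hii : ii ^+ 2 = -1).

(** The intertwiner from [sgn (x) st] to [st], unique up to a scalar: [v |-> v - 2w],
    [w |-> 2v - w]. Its square is -3, hence it is invertible when 3 is. *)
Definition sgn_twist : 'M[k]_2 := mx2 1 (- 2%:R) 2%:R (- 1).

Lemma sgn_twist_unit : sgn_twist \in unitmx.
Proof.
have JJ : sgn_twist *m ((- 3%:R^-1) *: sgn_twist) = 1%:M.
  rewrite -scalemxAr mx2M; apply/matrixP; apply: ord2_ind; apply: ord2_ind;
  rewrite !mxE /=; field => //.
by case/mulmx1_unit: JJ.
Qed.

Lemma sgn_twist12 :
  sgn_twist *m std_mx k (val t12) = - (std_mx k (val t12) *m sgn_twist).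
Proof. by rewrite std_mxE !mx2E; congr mx2; ring. Qed.

Lemma sgn_twist23 :
  sgn_twist *m std_mx k (val t23) = - (std_mx k (val t23) *m sgn_twist).
Proof. by rewrite std_mxE !mx2E; congr mx2; ring. Qed.

Lemma sgn_mx_odd (t : 'S_3) : odd_perm t -> sgn_mx k t = - 1%:M.
Proof. by rewrite /sgn_mx => ->; rewrite expr1 raddfN. Qed.

(** Since [H_12] acts on the sign by -1, [a_12] acts on the tensor product as minus its action on
    the standard factor; this is the sign in [twistA]. Elements [X] are rows here, whence the
    transpose in the isomorphism. *)
Lemma sgn_tensor_S_st h h' : sg h = sg h' -> absth h <> absth h' ->
  A1iso (A1tensor (S_sgn k) (S_st ii h)) (S_st ii h').
Proof.
move=> sgE absE; rewrite (swap_absP sgE absE).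
have twistA : sgn_twist *m S_st_mx ii h = - (S_st_mx ii (swap_abs h) *m sgn_twist).
  by case: h {sgE absE}; rewrite !mx2E; congr mx2 => /=; field => //.
rewrite !S_stE; apply: (@A1iso_tensor_mx _ _ _ _ _ _ _ _ _ _ (mulmx sgn_twist \o trmx)).
- exact: S_sgn_module.
- by rewrite -S_stE; apply: S_st_module.
- exact: std_rep.
- apply: bij_comp; last by exists trmx; apply: trmxK.
  exists (mulmx (invmx sgn_twist)).
  + exact: (mulKmx sgn_twist_unit).
  + exact: (mulKVmx sgn_twist_unit).
- move=> X; rewrite /= sgn_mx_odd ?odd_tperm // mulNmx mul1mx mulNmx linearN /=.
  by rewrite trmx_mul trmxK mulmxN !mulmxA sgn_twist12 mulNmx opprK.
- move=> X; rewrite /= sgn_mx_odd ?odd_tperm // mulNmx mul1mx mulNmx linearN /=.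
  by rewrite trmx_mul trmxK mulmxN !mulmxA sgn_twist23 mulNmx opprK.
- move=> X; rewrite /= sgn_mx_odd ?odd_tperm // mulNmx mul1mx mulNmx mul0mx addr0.
  by rewrite linearN /= trmx_mul trmxK mulmxN !mulmxA twistA mulNmx opprK.
Qed.

(** Now only [a_12 (x) 1] survives, so [twistA] has no sign. Compared with the sign on the left, the
    parameter is therefore negated. *)
Lemma S_st_tensor_sgn h h' : sg h = - sg h' -> absth h <> absth h' ->
  A1iso (A1tensor (S_st ii h) (S_sgn k)) (S_st ii h').
Proof.
move=> sgE absE; have -> : h' = swap_abs (swap_sg h).
  by apply: swap_absP; rewrite ?absth_swap // sg_swap sgE opprK.
have twistA : sgn_twist *m S_st_mx ii h = S_st_mx ii (swap_abs (swap_sg h)) *m sgn_twist.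
  by case: h {sgE absE}; rewrite !mx2E; congr mx2 => /=; field => //.
rewrite !S_stE; apply: (@A1iso_tensor_mx _ _ _ _ _ _ _ _ _ _ (mulmx sgn_twist)).
- by rewrite -S_stE; apply: S_st_module.
- exact: S_sgn_module.
- exact: std_rep.
- exists (mulmx (invmx sgn_twist)).
  + exact: (mulKmx sgn_twist_unit).
  + exact: (mulKVmx sgn_twist_unit).
- move=> X; rewrite sgn_mx_odd ?odd_tperm // linearN /= trmx1 mulmxN mulmx1.
  by rewrite mulmxN !mulmxA sgn_twist12 mulNmx opprK.
- move=> X; rewrite sgn_mx_odd ?odd_tperm // linearN /= trmx1 mulmxN mulmx1.
  by rewrite mulmxN !mulmxA sgn_twist23 mulNmx opprK.
- by move=> X; rewrite /= trmx0 mulmx0 add0r !mulmxA twistA.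
Qed.

End Sgn.

(** * Tensor products of two standard modules *)

Section StdStd.
Variable k : fieldType.

(* [std2_split 1 1] is an S_3-isomorphism from st (x) st to triv + sgn + st;
   [p] and [q] scale its components on the trivial and sign summands. *)
Definition std2_split (p q : k) (X : 'M[k]_2) : 'cV[k]_(1 + 1 + 2) :=
  let a := X ord0 ord0 in let b := X ord_max ord0 in
  let c := X ord0 ord_max in let d := X ord_max ord_max in
  col4 (p * (2%:R * a + b + c + 2%:R * d)) (q * (c - b))
       (a - b - c - 2%:R * d) (d - b - c - 2%:R * a).

Lemma std2_split_linear p q : linear (std2_split p q).
Proof.
by move=> s X Y; apply/colP; apply: ord4_ind; rewrite !mxE /=; ring.
Qed.

HB.instance Definition _ p q :=
  GRing.isLinear.Build k _ _ _ (std2_split p q) (std2_split_linear p q).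

Lemma std2_splitE p q a b c d : std2_split p q (mx2 a b c d) =
  col4 (p * (2%:R * a + b + c + 2%:R * d)) (q * (c - b))
       (a - b - c - 2%:R * d) (d - b - c - 2%:R * a).
Proof. by rewrite /std2_split !mxE. Qed.

Lemma std2_split_bij p q : 2%:R != 0 :> k -> 3%:R != 0 :> k ->
  p != 0 -> q != 0 -> bijective (std2_split p q).
Proof.
move=> n2 n3 p0 q0.
(* For [X = mx2 a b c d], put [t = a + d] and [s = b + c]. The coordinates, after division by [p]
   and [q], satisfy [x = s + 2t], [v + w = - t - 2s], [v - w = 3(a - d)] and [y = c - b], which is
   solved for the entries. *)
exists (fun u : 'cV[k]_(1 + 1 + 2) =>
  let x := u (lshift 2 (lshift 1 0)) 0 / p in
  let y := u (lshift 2 (rshift 1 0)) 0 / q in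
  let v := u (rshift (1 + 1) ord0) 0 in
  let w := u (rshift (1 + 1) ord_max) 0 in
  let t := (v + w + 2%:R * x) / 3%:R in
  let s := x - 2%:R * t in
  mx2 ((t + (v - w) / 3%:R) / 2%:R) ((s - y) / 2%:R)
      ((s + y) / 2%:R) ((t - (v - w) / 3%:R) / 2%:R)) => [X|u].
  have [a [b [c [d ->]]]] := mx2_eta X.
  by rewrite std2_splitE /= !mxE /=; congr mx2; field; rewrite ?n2 ?n3 ?p0 ?q0.
have [x [y [v [w ->]]]] := col4_eta u.
by rewrite /= std2_splitE !mxE /=; congr col4; field; rewrite ?n2 ?n3 ?p0 ?q0.
Qed.

Definition M_amx (ii al be ga et a b : k) h : 'M[k]_(1 + 1 + 2) :=
  let c := th_val ii h in
  let d := match h with PosI | NegI => - c | PosI3 | NegI3 => c end in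
  mx4 [:: 0; al; be; - be] [:: ga; 0; et; et] [:: a; b; c; d] [:: - a; b; - d; - c].

(** S_3-equivariance of [std2_split p q] holds for all [p] and [q], which only rescale isotypic
    components. What remains as a hypothesis is compatibility with [a_12]. *)
Lemma S_st_tensor_S_st (ii al be ga et a b p q : k) h1 h2 h :
  2%:R != 0 :> k -> 3%:R != 0 :> k -> ii ^+ 2 = -1 -> p != 0 -> q != 0 ->
  (forall X, std2_split p q (std_mx k (val t12) *m X *m (S_st_mx ii h2)^T
                              + S_st_mx ii h1 *m X)
             = M_amx ii al be ga et a b h *m std2_split p q X) ->
  A1iso (A1tensor (S_st ii h1) (S_st ii h2)) (M ii al be ga et a b h).
Proof.
move=> n2 n3 hii p0 q0 fa; rewrite !S_stE.
apply: (@A1iso_tensor_mx _ _ _ _ _ _ _ _ _ _ (std2_split p q)) => //.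
- by rewrite -S_stE; apply: S_st_module.
- by rewrite -S_stE; apply: S_st_module.
- exact: M_rep.
- exact: std2_split_bij.
- move=> X; have [x [y [z [t ->]]]] := mx2_eta X.
  rewrite std_mxE M_mx12 !mx2E /= !std2_splitE mx4_col4 /=.
  by congr col4; ring.
- move=> X; have [x [y [z [t ->]]]] := mx2_eta X.
  rewrite std_mxE M_mx23 !mx2E /= !std2_splitE mx4_col4 /=.
  by congr col4; ring.
Qed.
End StdStd.

Ltac nonzero :=
  rewrite ?(oppr_eq0, mulf_eq0, invr_eq0, oner_eq0, negb_or);
  by do ?[apply/andP; split].

(** Leaves the four coordinates of compatibility with [a_12]. Scaling by [p] and [q] multiplies the
    parameters [a] by [p] and [b] by [q], and divides [be] by [p] and [et] by [q]. In each target
    either [be, et] or [a, b] are nonzero, and [p, q] are read off from that pair. *)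
Ltac std2_iso p q :=
  apply: (@S_st_tensor_S_st _ _ _ _ _ _ _ _ p q);
  [ assumption | assumption | assumption | nonzero | nonzero
  | let X := fresh "X" in
    move=> X; have [? [? [? [? ->]]]] := mx2_eta X;
    rewrite std_mxE !mx2E !std2_splitE mx4_col4 /=;
    congr col4 ].

Theorem proposition5p12 (k : closedFieldType) (char0 : [pchar k] =i pred0)
    (ii : k) (hii : ii ^+ 2 = -1) :
  [/\ (* (1) *)
      forall S : A1data k, A1simple S ->
        A1iso (A1tensor (S_eps k) S) S /\ A1iso S (A1tensor S (S_eps k)),
      (* (2) *)
      forall h h' : theta, sg h = sg h' -> absth h <> absth h' ->
        A1iso (A1tensor (S_sgn k) (S_st ii h)) (S_st ii h'),
      (* (3) *)
      forall h h' : theta, sg h = - sg h' -> absth h <> absth h' ->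
        A1iso (A1tensor (S_st ii h) (S_sgn k)) (S_st ii h') &
      (* (4) *)
      let T h h' := A1tensor (S_st ii h) (S_st ii h') in
      (A1iso (T PosI PosI) (T NegI3 PosI3) /\
       A1iso (T NegI3 PosI3) (M ii 0 (2 * ii) 1 1 0 0 NegI)) /\
      (A1iso (T PosI NegI) (T NegI3 NegI3) /\
       A1iso (T NegI3 NegI3) (M ii 1 0 0 0 (- (2 * ii / 3)) 1 PosI3)) /\
      (A1iso (T PosI PosI3) (T NegI3 PosI) /\
       A1iso (T NegI3 PosI) (M ii 0 0 1 0 1 (2 * ii) NegI)) /\
      (A1iso (T PosI NegI3) (T NegI3 NegI) /\
       A1iso (T NegI3 NegI) (M ii 1 1 0 (- (2 * ii / 3)) 0 0 PosI3)) /\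
      (A1iso (T NegI PosI) (T PosI3 PosI3) /\
       A1iso (T PosI3 PosI3) (M ii 1 0 0 0 (2 * ii / 3) 1 NegI3)) /\
      (A1iso (T NegI NegI) (T PosI3 NegI3) /\
       A1iso (T PosI3 NegI3) (M ii 0 (- (2 * ii)) 1 1 0 0 PosI)) /\
      (A1iso (T NegI PosI3) (T PosI3 PosI) /\
       A1iso (T PosI3 PosI) (M ii 1 1 0 (2 * ii / 3) 0 0 NegI3)) /\
      (A1iso (T NegI NegI3) (T PosI3 NegI) /\
       A1iso (T PosI3 NegI) (M ii 0 0 1 0 1 (- (2 * ii)) PosI))].
Proof.
have nz n : n.+1%:R != 0 :> k by rewrite ((pcharf0P k).1 char0).
have n2 : 2 != 0 :> k := nz 1; have n3 : 3 != 0 :> k := nz 2.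
have i0 : ii != 0.
  by apply/eqP=> i0; have/eqP := hii; rewrite i0 expr0n eq_sym oppr_eq0 oner_eq0.
split.
- move=> S [mS _ _]; split; first exact: S_eps_tensor.
  exact/A1iso_sym/tensor_S_eps.
- by move=> h h'; apply: sgn_tensor_S_st.
- by move=> h h'; apply: S_st_tensor_sgn.
move=> T.
(* Both tensor products are compared with the module [N]; the isomorphism between them is the
   composite through [N]. *)
have both h1 h2 h3 h4 N : A1iso (T h1 h2) N -> A1iso (T h3 h4) N ->
    A1iso (T h1 h2) (T h3 h4) /\ A1iso (T h3 h4) N.
  move=> i1 i2; split; last exact: i2.
  exact: A1iso_trans i1 (A1iso_sym i2).
(* With the standard component normalized to 1, the scalars [p] and [q] are
   determined; negating both exchanges the two tensor products on each line. *)
split.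
- apply: both; [ std2_iso (2^-1 : k) (- ii)
             | std2_iso (- (2^-1) : k) ii ];
  field: hii; by rewrite ?n2 ?n3.
split.
- apply: both; [ std2_iso (- 1 : k) (3 / 2 * ii : k)
             | std2_iso (1 : k) (- (3 / 2 * ii) : k) ];
  field: hii; by rewrite ?n2 ?n3.
split.
- apply: both; [ std2_iso (- (3 / 2 * ii) : k) (- 3 : k)
             | std2_iso (3 / 2 * ii : k) (3 : k) ];
  field: hii; by rewrite ?n2 ?n3.
split.
- apply: both; [ std2_iso ii (3 / 2 : k)
             | std2_iso (- ii) (- (3 / 2) : k) ];
  field: hii; by rewrite ?n2 ?n3.
split.
- apply: both; [ std2_iso (- 1 : k) (- (3 / 2 * ii) : k)
             | std2_iso (1 : k) (3 / 2 * ii : k) ];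
  field: hii; by rewrite ?n2 ?n3.
split.
- apply: both; [ std2_iso (2^-1 : k) ii
             | std2_iso (- (2^-1) : k) (- ii) ];
  field: hii; by rewrite ?n2 ?n3.
split.
- apply: both; [ std2_iso (- ii) (3 / 2 : k)
             | std2_iso ii (- (3 / 2) : k) ];
  field: hii; by rewrite ?n2 ?n3.
apply: both; [ std2_iso (3 / 2 * ii : k) (- 3 : k)
             | std2_iso (- (3 / 2 * ii) : k) (3 : k) ];
  field: hii; by rewrite ?n2 ?n3.
Qed.
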